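(* Let $R$ be a commutative Noetherian semi-local ring of prime characteristic $p>0$, and let $M$ be an $x$-divisible right $R[x,f]$-module that is Noetherian as an $R$-module. Then there are only finitely many graded annihilators of $R[x,f]$-homomorphic images of $M$; that is, the set $\{\text{gr-ann}(M/N)_{R[x,f]} : N \text{ an } R[x,f]\text{-submodule of } M\}$ is finite.
   Context: $f:R\to R$, $f(r)=r^p$, is the Frobenius endomorphism. The Frobenius skew polynomial ring $R[x,f]$ is the free left $R$-module with basis $(x^i)_{i\in\mathbb{N}_0}$, with multiplication determined by $xr=f(r)x=r^px$ for $r\in R$; it is positively graded, $R[x,f]=\bigoplus_{n\in\mathbb{N}_0}Rx^n$. A right $R[x,f]$-module is viewed as an $R$-module by restriction to $R=Rx^0$. For a right $R[x,f]$-module $K$, the graded annihilator $\text{gr-ann}(K)_{R[x,f]}$ is the largest graded two-sided ideal of $R[x,f]$ annihilating $K$; explicitly it is the set of all finite sums $\sum_{i=0}^n r_ix^i$ ($r_i\in R$) such that $K(r_ix^i)=0$ for every $i$. $K$ is $x$-divisible if $K=Kx$. Semi-local means having only finitely many maximal ideals. *)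

(* Defs.v *)
From HB Require Import structures.
From mathcomp Require Import all_boot all_order all_algebra.
From mathcomp Require Import generic_quotient ring_quotient.
From mathcomp Require Import boolp classical_sets cardinality.

Set Implicit Arguments.
Unset Strict Implicit.
Unset Printing Implicit Defensive.

Import GRing.Theory.

Local Open Scope ring_scope.
Local Open Scope classical_set_scope.

(* Submodules and ideals are MathComp's bundled boolean predicates; under the
   axioms of boolp every subset of a type is the extension of such a
   predicate, so no generality is lost. *)

Definition noetherian (A : pzRingType) (V : lmodType A) : Prop :=
  forall N : nat -> submodClosed V,
    (forall i, {subset N i <= N i.+1}) ->
    exists n, forall m, (n <= m)%N -> N m =i N n.

(* The members of [idealr R] are proper by definition. *)
Definition maximal_ideal (R : comNzRingType) (I : idealr R) : Prop :=
  forall J : idealr R, {subset I <= J} -> {subset J <= I}.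

Definition semilocal (R : comNzRingType) : Prop :=
  finite_set [set [set` I] | I in @maximal_ideal R].

Section QuotientModule.
Variables (A : pzRingType) (V : lmodType A) (N : submodClosed V).

Let submod_zmod_closed : zmod_closed (N : {pred V}).
Proof. exact: GRing.submod_closedB (submodClosedP N). Qed.

Definition submod_pred : pred V := fun v => v \in N.

HB.instance Definition _ := GRing.isZmodClosed.Build V submod_pred
  submod_zmod_closed.

Definition submod_zmod : zmodClosed V := GRing.ZmodClosed.clone V submod_pred _.

Local Notation Q := (Quotient.quot submod_zmod).

Definition quot_mod : Type := Q.

HB.instance Definition _ := GRing.Zmodule.on quot_mod.

Local Open Scope quotient_scope.

Definition quot_proj (v : V) : quot_mod := \pi_Q v.

Lemma quot_projP v w : quot_proj v = quot_proj w <-> v - w \in N.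
Proof.
by split=> [/eqP|] h; [|apply/eqP]; move: h; rewrite -Quotient.idealrBE.
Qed.

Lemma quot_proj_surj (q : quot_mod) : exists v, quot_proj v = q.
Proof. by exists (repr (q : Q)); apply: reprK. Qed.

Lemma quot_proj_is_zmod_morphism : zmod_morphism quot_proj.
Proof. by move=> v w; apply: (raddfB \pi_Q). Qed.

Definition quot_scale (a : A) (q : quot_mod) : quot_mod :=
  quot_proj (a *: repr (q : Q)).

Lemma quot_projZ a v : quot_proj (a *: v) = quot_scale a (quot_proj v).
Proof.
apply/quot_projP; rewrite -scalerBr; apply: rpredZ.
by apply/quot_projP; rewrite {2}/quot_proj reprK.
Qed.

Let quot_projD v w : quot_proj (v + w) = quot_proj v + quot_proj w.
Proof. exact: (raddfD \pi_Q). Qed.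

Let quot_scaleA a b q : quot_scale a (quot_scale b q) = quot_scale (a * b) q.
Proof.
by have [v <-] := quot_proj_surj q; rewrite -!quot_projZ scalerA.
Qed.

Let quot_scale1 : left_id 1 quot_scale.
Proof.
by move=> q; have [v <-] := quot_proj_surj q; rewrite -quot_projZ scale1r.
Qed.

Let quot_scaleDr : right_distributive quot_scale +%R.
Proof.
move=> a q r; have [v <-] := quot_proj_surj q; have [w <-] := quot_proj_surj r.
by rewrite -quot_projD -!quot_projZ scalerDr quot_projD.
Qed.

Let quot_scaleDl q : {morph quot_scale^~ q : a b / a + b}.
Proof.
move=> a b; have [v <-] := quot_proj_surj q.
by rewrite -!quot_projZ scalerDl quot_projD.
Qed.

HB.instance Definition _ := GRing.Zmodule_isLmodule.Build A quot_mod
  quot_scaleA quot_scale1 quot_scaleDr quot_scaleDl.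

HB.instance Definition _ := GRing.isZmodMorphism.Build V quot_mod quot_proj
  quot_proj_is_zmod_morphism.
HB.instance Definition _ := GRing.isScalable.Build A V quot_mod *:%R quot_proj
  quot_projZ.

End QuotientModule.

(* The Frobenius skew polynomial ring R[x,f]: as a left R-module it is {poly R},
   the basis element x^i being 'X^i; only the multiplication changes. *)
Section FrobeniusSkewPolynomials.
Variables (R : comNzRingType) (p : nat) (chRp : p \in [pchar R]).

Definition frob_skew of p \in [pchar R] : Type := {poly R}.

Local Notation S := (frob_skew chRp).

HB.instance Definition _ := GRing.Lmodule.copy S {poly R}.

Definition skew_coef (a : S) (i : nat) : R := (a : {poly R})`_i.

Definition skew_monomial (r : R) (i : nat) : S := (r *: 'X^i : {poly R}).

Definition skew_one : S := (1 : {poly R}).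

(* (r x^i) (s x^j) = r f^i(s) x^(i+j), where f^i(s) = s^(p^i). *)
Definition skew_mul (a b : S) : S :=
  \sum_(i < size (a : {poly R})) \sum_(j < size (b : {poly R}))
     skew_monomial (skew_coef a i * skew_coef b j ^+ (p ^ i)) (i + j).

Let frob (i : nat) (r : R) := r ^+ (p ^ i).

Let frobD i r s : frob i (r + s) = frob i r + frob i s.
Proof.
rewrite /frob; elim: i r s => [|i IH] r s; first by rewrite !expn0 !expr1.
by rewrite expnSr !exprM IH -[LHS](pFrobenius_autE chRp) rmorphD.
Qed.

Let frobM i r s : frob i (r * s) = frob i r * frob i s.
Proof. exact: exprMn. Qed.

Let frob_comp i j r : frob i (frob j r) = frob (i + j) r.
Proof. by rewrite /frob -exprM -expnD addnC. Qed.

Let frob0 i : frob i 0 = 0.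
Proof.
have p_gt0 : (0 < p)%N by apply: prime_gt0; case/andP: chRp.
by rewrite /frob expr0n expn_eq0 (gtn_eqF p_gt0).
Qed.

Let shift i (b : {poly R}) : {poly R} := \sum_(j < size b) (frob i b`_j) *: 'X^(i + j).

Let shift_widen i n (b : {poly R}) : (size b <= n)%N ->
  shift i b = \sum_(j < n) (frob i b`_j) *: 'X^(i + j).
Proof.
move=> le_bn; rewrite /shift.
rewrite (big_ord_widen n (fun j => (frob i b`_j) *: 'X^(i + j))) //.
rewrite big_mkcond; apply: eq_bigr => j _; case: ltnP => // le_bj.
by rewrite nth_default // frob0 scale0r.
Qed.

Let shiftD i b c : shift i (b + c) = shift i b + shift i c.
Proof.
pose n := maxn (size b) (size c).
rewrite !(@shift_widen i n) ?leq_maxl ?leq_maxr ?size_polyD // -big_split /=.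
by apply: eq_bigr => j _; rewrite coefD frobD scalerDl.
Qed.

Let shift0 i : shift i 0 = 0.
Proof. by rewrite /shift size_poly0 big_ord0. Qed.

Let shiftZ i r b : shift i (r *: b) = frob i r *: shift i b.
Proof.
rewrite !(@shift_widen i (size b)) ?size_scale_leq // scaler_sumr.
by apply: eq_bigr => j _; rewrite coefZ frobM scalerA.
Qed.

Let shift_sum i n (F : 'I_n -> {poly R}) :
  shift i (\sum_j F j) = \sum_j shift i (F j).
Proof. exact: (big_morph _ (shiftD i) (shift0 i)). Qed.

Let shiftXn i j : shift i 'X^j = 'X^(i + j).
Proof.
rewrite /shift size_polyXn big_ord_recr /= coefXn eqxx.
rewrite /frob expr1n scale1r big1 ?add0r // => k _.
by rewrite coefXn (ltn_eqF (ltn_ord k)) -/(frob i 0) frob0 scale0r.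
Qed.

Let shift_shift i j b : shift i (shift j b) = shift (i + j) b.
Proof.
rewrite [shift j b]/shift shift_sum; apply: eq_bigr => k _.
by rewrite shiftZ frob_comp shiftXn addnA.
Qed.

Let mul (a b : {poly R}) : {poly R} := \sum_(i < size a) a`_i *: shift i b.

Let skew_mulE (a b : S) : skew_mul a b = mul a b.
Proof.
apply: eq_bigr => i _; rewrite scaler_sumr; apply: eq_bigr => j _.
by rewrite scalerA.
Qed.

Let mul_widen n (a b : {poly R}) : (size a <= n)%N ->
  mul a b = \sum_(i < n) a`_i *: shift i b.
Proof.
move=> le_an; rewrite /mul (big_ord_widen n (fun i => a`_i *: shift i b)) //.
rewrite big_mkcond; apply: eq_bigr => j _; case: ltnP => // le_bj.
by rewrite nth_default // scale0r.
Qed.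

Let mulDl a b c : mul (a + b) c = mul a c + mul b c.
Proof.
pose n := maxn (size a) (size b).
rewrite !(@mul_widen n) ?leq_maxl ?leq_maxr ?size_polyD // -big_split /=.
by apply: eq_bigr => j _; rewrite coefD scalerDl.
Qed.

Let mul0 c : mul 0 c = 0.
Proof. by rewrite /mul size_poly0 big_ord0. Qed.

Let mulZ r a c : mul (r *: a) c = r *: mul a c.
Proof.
rewrite !(@mul_widen (size a)) ?size_scale_leq // scaler_sumr.
by apply: eq_bigr => j _; rewrite coefZ scalerA.
Qed.

Let mul_sum n (F : 'I_n -> {poly R}) c :
  mul (\sum_j F j) c = \sum_j mul (F j) c.
Proof. exact: (big_morph (mul^~ c) (fun a b => mulDl a b c) (mul0 c)). Qed.

Let mulXn i c : mul 'X^i c = shift i c.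
Proof.
rewrite /mul size_polyXn big_ord_recr /= coefXn eqxx scale1r.
rewrite big1 ?add0r // => k _.
by rewrite coefXn (ltn_eqF (ltn_ord k)) scale0r.
Qed.

Let mul_shift i b c : mul (shift i b) c = shift i (mul b c).
Proof.
rewrite [shift i b]/shift mul_sum [mul b c]/mul shift_sum.
by apply: eq_bigr => j _; rewrite mulZ mulXn shiftZ shift_shift.
Qed.

Let skew_mulA : associative skew_mul.
Proof.
move=> a b c; rewrite !skew_mulE [mul a b]/mul mul_sum; apply: eq_bigr => i _.
by rewrite mulZ mul_shift.
Qed.

Let skew_mul1 : left_id skew_one skew_mul.
Proof.
move=> a; rewrite skew_mulE /skew_one -[(1 : {poly R})]/('X^0) mulXn /shift -[RHS]coefK poly_def.
by apply: eq_bigr => j _; rewrite /frob expn0 expr1.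
Qed.

Let skew_mulr1 : right_id skew_one skew_mul.
Proof.
move=> a; rewrite skew_mulE /mul -[RHS]coefK poly_def.
apply: eq_bigr => j _; rewrite /skew_one -[(1 : {poly R})]/('X^0).
by rewrite shiftXn addn0.
Qed.

Let skew_mulDl : left_distributive skew_mul +%R.
Proof. by move=> a b c; rewrite !skew_mulE mulDl. Qed.

Let skew_mulDr : right_distributive skew_mul +%R.
Proof.
move=> a b c; rewrite !skew_mulE /mul -big_split /=.
by apply: eq_bigr => i _; rewrite shiftD scalerDr.
Qed.

Let skew_one_neq0 : skew_one != 0.
Proof. exact: (oner_neq0 {poly R}). Qed.

HB.instance Definition _ := GRing.Zmodule_isNzRing.Build S
  skew_mulA skew_mul1 skew_mulr1 skew_mulDl skew_mulDr skew_one_neq0.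

(* The embedding of R as the degree 0 component R x^0. *)
Definition skew_const (r : R) : S := skew_monomial r 0.

Definition skew_x : S := skew_monomial 1 1.

Lemma skew_monomialM r i s j :
  skew_monomial r i * skew_monomial s j
  = skew_monomial (r * s ^+ (p ^ i)) (i + j).
Proof.
rewrite [LHS]skew_mulE /skew_monomial mulZ mulXn shiftZ shiftXn.
by rewrite scalerA.
Qed.

Lemma skew_const_is_zmod_morphism : zmod_morphism skew_const.
Proof. by move=> r s; apply: (scalerBl r s ('X^0 : {poly R})). Qed.

Lemma skew_const_is_monoid_morphism : monoid_morphism skew_const.
Proof.
split; first exact: (scale1r ('X^0 : {poly R})).
by move=> r s; rewrite skew_monomialM expn0 expr1.
Qed.

HB.instance Definition _ := GRing.isZmodMorphism.Build R S skew_const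
  skew_const_is_zmod_morphism.
HB.instance Definition _ := GRing.isMonoidMorphism.Build R S skew_const
  skew_const_is_monoid_morphism.

Lemma skew_xM r : skew_x * skew_const r = skew_const (r ^+ p) * skew_x.
Proof. by rewrite !skew_monomialM expn1 expr1n mul1r mulr1 addn0. Qed.

Lemma skew_xX i : skew_x ^+ i = skew_monomial 1 i.
Proof.
elim: i => [|i IH]; first by rewrite expr0 -[LHS](rmorph1 skew_const).
by rewrite exprS IH skew_monomialM expr1n mulr1 add1n.
Qed.

Lemma skew_monomialE r i : skew_monomial r i = skew_const r * skew_x ^+ i.
Proof. by rewrite skew_xX skew_monomialM expn0 expr1 mulr1 add0n. Qed.

Lemma skew_expand (a : S) :
  a = \sum_(i < size (a : {poly R})) skew_const (skew_coef a i) * skew_x ^+ i.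
Proof.
rewrite -[LHS](coefK (a : {poly R})) poly_def.
by apply: eq_bigr => i _; rewrite -skew_monomialE.
Qed.

Lemma skew_coef_monomial r i j :
  skew_coef (skew_monomial r i) j = if j == i then r else 0.
Proof. by rewrite /skew_coef coefZ coefXn; case: eqP; rewrite (mulr1, mulr0). Qed.

End FrobeniusSkewPolynomials.

(* A right A-module is a left module over the converse ring A^c. *)
Definition ract (A : pzRingType) (K : lmodType A^c) (k : K) (a : A) : K :=
  (a : A^c) *: k.

Lemma ractM (A : pzRingType) (K : lmodType A^c) (k : K) (a b : A) :
  ract k (a * b) = ract (ract k a) b.
Proof. by rewrite /ract scalerA. Qed.

(* R being commutative, the restricted right action of R is also a left one. *)
Section Restriction.
Variables (R : comNzRingType) (p : nat) (chRp : p \in [pchar R]).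
Variable K : lmodType (frob_skew chRp)^c.

Definition restrict_scalars : Type := K.

HB.instance Definition _ := GRing.Zmodule.on restrict_scalars.

Definition restrict_scale (r : R) (k : restrict_scalars) : restrict_scalars :=
  ract (k : K) (skew_const chRp r).

Let restrict_scaleA r s k :
  restrict_scale r (restrict_scale s k) = restrict_scale (r * s) k.
Proof. by rewrite /restrict_scale -ractM -rmorphM mulrC. Qed.

Let restrict_scale1 : left_id 1 restrict_scale.
Proof. by move=> k; rewrite /restrict_scale rmorph1; apply: scale1r. Qed.

Let restrict_scaleDr : right_distributive restrict_scale +%R.
Proof. by move=> r k l; apply: scalerDr. Qed.

Let restrict_scaleDl k : {morph restrict_scale^~ k : r s / r + s}.
Proof. by move=> r s; rewrite /restrict_scale rmorphD; apply: scalerDl. Qed.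

HB.instance Definition _ := GRing.Zmodule_isLmodule.Build R restrict_scalars
  restrict_scaleA restrict_scale1 restrict_scaleDr restrict_scaleDl.

Definition x_divisible : Prop :=
  forall k : K, exists l : K, k = ract l (skew_x chRp).

Definition gr_ann : set (frob_skew chRp) :=
  [set a | forall (i : nat) (k : K), ract k (skew_monomial chRp (skew_coef a i) i) = 0].

End Restriction.

(* The explicit set gr_ann K is the largest graded two-sided ideal annihilating K. *)
Section GradedAnnihilator.
Variables (R : comNzRingType) (p : nat) (chRp : p \in [pchar R]).
Local Notation S := (frob_skew chRp).

Definition two_sided_ideal (I : set S) : Prop :=
  [/\ I 0, (forall a b, I a -> I b -> I (a + b)),
      (forall a b, I b -> I (a * b)) & (forall a b, I a -> I (a * b))].

Definition graded (I : set S) : Prop :=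
  forall a, I a -> forall i, I (skew_monomial chRp (skew_coef a i) i).

Definition annihilates (K : lmodType S^c) (I : set S) : Prop :=
  forall (k : K) (a : S), I a -> ract k a = 0.

Lemma ract_sum (K : lmodType S^c) (k : K) n (F : 'I_n -> S) :
  ract k (\sum_i F i) = \sum_i ract k (F i).
Proof.
apply: (big_morph (ract k)); last exact: scale0r.
by move=> a b; apply: scalerDl.
Qed.

Lemma gr_ann_annihilates (K : lmodType S^c) : annihilates K (gr_ann K).
Proof.
move=> k a Ia; rewrite [a]skew_expand ract_sum big1 // => i _.
by rewrite -skew_monomialE.
Qed.

Lemma gr_ann_graded (K : lmodType S^c) : graded (gr_ann K).
Proof.
move=> a Ia i j k; rewrite skew_coef_monomial; case: eqP => [-> //|_].
by rewrite /skew_monomial scale0r; apply: scale0r.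
Qed.

Lemma gr_ann_max (K : lmodType S^c) (I : set S) :
  graded I -> annihilates K I -> I `<=` gr_ann K.
Proof. by move=> gI aI a Ia i k; apply/aI/gI. Qed.

Lemma gr_ann_ideal (K : lmodType S^c) : two_sided_ideal (gr_ann K).
Proof.
have monoD r s i : skew_monomial chRp (r + s) i
    = skew_monomial chRp r i + skew_monomial chRp s i.
  exact: (scalerDl _ r s).
have I0 : gr_ann K 0.
  move=> i k; rewrite /skew_coef coef0 /skew_monomial scale0r; exact: scale0r.
have ID a b : gr_ann K a -> gr_ann K b -> gr_ann K (a + b).
  move=> Ia Ib i k; rewrite /skew_coef coefD monoD.
  rewrite [LHS](scalerDl k) -[RHS]addr0; congr (_ + _); first exact: Ia.
  exact: Ib.
have Isum n (F : 'I_n -> S) : (forall i, gr_ann K (F i)) ->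
    gr_ann K (\sum_i F i).
  by move=> IF; apply: big_ind.
have Imono r i : (forall k : K, ract k (skew_monomial chRp r i) = 0) ->
    gr_ann K (skew_monomial chRp r i).
  move=> Ir j k; rewrite skew_coef_monomial; case: eqP => [-> //|_].
  by rewrite /skew_monomial scale0r; apply: scale0r.
split=> // a b Iab.
- rewrite [a]skew_expand [b]skew_expand mulr_suml; apply: (@Isum _ _) => i.
  rewrite mulr_sumr; apply: (@Isum _ _) => j; rewrite -!skew_monomialE skew_monomialM.
  by apply: Imono => k; rewrite -skew_monomialM ractM; apply: Iab.
- rewrite [a]skew_expand [b]skew_expand mulr_suml; apply: (@Isum _ _) => i.
  rewrite mulr_sumr; apply: (@Isum _ _) => j; rewrite -!skew_monomialE skew_monomialM.
  apply: Imono => k; rewrite -skew_monomialM ractM Iab; exact: scaler0.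
Qed.

End GradedAnnihilator.

(* Main.v *)
From HB Require Import structures.
Require Import Defs.
From mathcomp Require Import all_boot all_order all_algebra.
From mathcomp Require Import ring_quotient.
From mathcomp Require Import boolp classical_sets functions cardinality.

Set Implicit Arguments.
Unset Strict Implicit.
Unset Printing Implicit Defensive.

Import GRing.Theory.

Local Open Scope ring_scope.
Local Open Scope classical_set_scope.

(** Write [phi] for the action of [x] on [M].  It is additive and satisfies
    [phi (r^p v) = r (phi v)], and divisibility says that it is surjective.  The
    submodules of [M] are the R-submodules stable under [phi], the Cartier
    submodules.  Surjectivity shows that [r x^i] kills [M / N] only if [r] does
    ([quotient_kills_monomial]), so that the graded annihilator of [M / N] is
    determined by the special ideal [quotient_ann N], the annihilator of [M / N]
    in [R]; the theorem becomes the finiteness of the set of special ideals.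

    For the same reason special ideals are radical ([special_radical]), and they
    are stable under colons ([special_colon]).  Hence a special ideal is the
    intersection of the special primes that contain it
    ([special_prime_avoiding]), and it suffices to bound the special primes.

    For a subset [A] of [R], consider the special primes maximal among those that
    do not contain [A].  Let [T] be the Cartier submodule generated by [A M].  If
    [Q i = quotient_ann (N i)] are such primes, the submodules [T `&` N i] of [T]
    are pairwise comaximal, and even independent
    ([maximal_special_comaximal]): a failure would produce a special prime above
    two of the [Q i] and still not containing [A].  As [R] is semi-local and [T] is finitely generated, [T]
    has no infinite independent family of proper submodules, so that there are
    finitely many such primes ([maximal_special_prime_finite]).

    Applied with [A] the intersection of the special primes already found, this
    shows that for each [k] there are finitely many special primes above which
    one cannot stack [k] others ([special_prime_level_finite]).  By Krull's
    height theorem ([height_le_generators]) chains of primes in a semi-local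
    Noetherian ring have bounded length, so some [k] exhausts all special
    primes.

    Both the independence argument and the principal ideal theorem
    ([no_prime_between]) need the descending chain condition for a module of
    finite length over the localization at a prime;
    [descending_chain_stops] gives it without forming localizations or
    lengths, through submodules that are saturated with respect to the prime. *)

(** * Submodules of Noetherian modules *)

Section Submodules.
Variables (R : comNzRingType) (V : lmodType R).
Implicit Types (N L T : set V) (P : set R).

Definition submodule N : Prop :=
  N 0 /\ forall a u v, N u -> N v -> N (a *: u + v).

Definition adjoin N (v : V) : set V := [set u | exists c, N (u - c *: v)].

(** For a prime [P] this is the contraction to [V] of the localization of [N]
    at [P]; working with it replaces working over the local ring at [P]. *)
Definition saturation P N : set V := [set u | exists2 s, ~ P s & N (s *: u)].

Definition saturated P T N : Prop :=
  forall s u, ~ P s -> T u -> N (s *: u) -> N u.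

Lemma submodule0 N : submodule N -> N 0.
Proof. by case. Qed.

Lemma submoduleZ N a u : submodule N -> N u -> N (a *: u).
Proof. by case=> N0 NP Nu; rewrite -[_ *: _]addr0; apply: NP. Qed.

Lemma submoduleD N u v : submodule N -> N u -> N v -> N (u + v).
Proof. by case=> N0 NP Nu Nv; rewrite -[u]scale1r; apply: NP. Qed.

Lemma submoduleB N u v : submodule N -> N u -> N v -> N (u - v).
Proof.
by move=> sN Nu Nv; apply: submoduleD => //; rewrite -scaleN1r; apply: submoduleZ.
Qed.

Lemma submodule_subl N u v : submodule N -> N (u - v) -> N v -> N u.
Proof. by move=> sN Nuv Nv; rewrite -(subrK v u); apply: submoduleD. Qed.

Lemma submoduleI N L : submodule N -> submodule L -> submodule (N `&` L).
Proof.
move=> [N0 NP] [L0 LP]; split=> // a u v [Nu Lu] [Nv Lv].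
by split; [apply: NP | apply: LP].
Qed.

Lemma submodule_bigcap I (D : set I) (F : I -> set V) :
  (forall i, D i -> submodule (F i)) -> submodule (\bigcap_(i in D) F i).
Proof.
move=> sF; split=> [i /sF [] //|a u v Fu Fv i Di].
by case: (sF i Di) => _; apply; [apply: Fu | apply: Fv].
Qed.

Lemma submodule_adjoin N v : submodule N -> submodule (adjoin N v).
Proof.
move=> sN; split=> [|a u w [c Nc] [d Nd]].
  by exists 0; rewrite scale0r subr0; apply: submodule0.
exists (a * c + d); rewrite scalerDl -scalerA opprD addrACA -scalerBr.
by apply: submoduleD => //; apply: submoduleZ.
Qed.

Lemma adjoin_mem N v : submodule N -> adjoin N v v.
Proof. by move=> sN; exists 1; rewrite scale1r subrr; apply: submodule0. Qed.

Lemma sub_adjoin N v : N `<=` adjoin N v.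
Proof. by move=> u Nu; exists 0; rewrite scale0r subr0. Qed.

(** The only use of the ascending chain condition: it is turned once and for all
    into the existence of maximal members. *)
Lemma noetherian_maximal (F : set (set V)) N0 : noetherian V ->
    (forall N, F N -> submodule N) -> F N0 ->
  exists N, [/\ F N, N0 `<=` N & forall N', F N' -> N `<=` N' -> N' `<=` N].
Proof.
move=> noethV sF FN0; apply: contrapT => nomax.
have step N : F N /\ N0 `<=` N -> exists N', [/\ F N', N `<=` N' & ~ N' `<=` N].
  move=> [FN N0N]; apply: contrapT => noN'; apply: nomax; exists N; split=> //.
  move=> N' FN' NN'; apply: contrapT => N'N; apply: noN'.
  by exists N'; split.
have stepT N : exists N', F N /\ N0 `<=` N -> [/\ F N', N `<=` N' & ~ N' `<=` N].
  case: (pselect (F N /\ N0 `<=` N)) => [h|h]; last by exists set0 => /h.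
  by have [N' N'P] := step N h; exists N'.
have [f fP] := boolp.choice stepT.
pose C n := iter n f N0.
have CP n : F (C n) /\ N0 `<=` C n.
  elim: n => [|n [IH1 IH2]]; first by split.
  have [h1 h2 _] := fP _ (conj IH1 IH2); split=> //.
  exact: subset_trans IH2 h2.
pose B n : pred V := fun v => `[< C n v >].
have closedB n : submod_closed (B n : {pred V}).
  have [s0 sP] := sF _ (proj1 (CP n)); split; first exact/asboolP.
  by move=> a u v /asboolP Cu /asboolP Cv; apply/asboolP; apply: sP.
pose BS n : submodClosed V := HB.pack_for (submodClosed V) (B n)
  (GRing.isSubmodClosed.Build R V (B n) (closedB n)).
have [n|n nP] := noethV BS.
  have [_ h _] := fP _ (CP n).
  by move=> v /asboolP Cv; apply/asboolP; apply: h.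
have [_ _ []] := fP _ (CP n) => v Cv.
have := nP n.+1 (leqnSn n) v => /esym e.
by apply/asboolP; change (v \in BS n); rewrite e; apply/asboolP.
Qed.


Lemma submodule_saturation P N :
    (forall s t, ~ P s -> ~ P t -> ~ P (s * t)) -> ~ P 1 ->
  submodule N -> submodule (saturation P N).
Proof.
move=> PM P1 sN; split=> [|a u v [s Ps Nu] [t Pt Nv]].
  by exists 1 => //; rewrite scaler0; apply: submodule0.
exists (s * t); first exact: PM.
rewrite scalerDr; apply: submoduleD => //.
  by rewrite !scalerA -mulrA mulrC -scalerA; apply: submoduleZ.
by rewrite -scalerA; apply: submoduleZ.
Qed.

Lemma sub_saturation P N : ~ P 1 -> N `<=` saturation P N.
Proof. by move=> P1 u Nu; exists 1 => //; rewrite scale1r. Qed.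

Lemma saturation_saturated P T N :
  (forall s t, ~ P s -> ~ P t -> ~ P (s * t)) -> saturated P T (saturation P N).
Proof.
move=> PM s u Ps _ [t Pt Nu]; exists (t * s); first exact: PM.
by rewrite -scalerA.
Qed.

Lemma saturation_sub P N L : N `<=` L -> saturated P setT L -> saturation P N `<=` L.
Proof. by move=> NL sL u [s Ps Nu]; apply: (sL s) => //; apply: NL. Qed.

End Submodules.

(** * Ideals and primes *)

Section Ideals.
Variable R : comNzRingType.
Implicit Types (I P Q S : set R).

Definition ideal I : Prop := @submodule R R^o I.

Definition prime_ideal P : Prop :=
  [/\ ideal P, ~ P 1 & forall a b, P (a * b) -> P a \/ P b].

Definition proper_maximal P : Prop :=
  [/\ ideal P, ~ P 1 & forall r, ~ P r -> exists u, P (1 - u * r)].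

Lemma ideal_mull I a r : ideal I -> I r -> I (a * r).
Proof. by move=> iI Ir; apply: (submoduleZ (V := R^o)). Qed.

Lemma ideal_mulr I a r : ideal I -> I r -> I (r * a).
Proof. by rewrite mulrC; apply: ideal_mull. Qed.

Lemma idealD I r s : ideal I -> I r -> I s -> I (r + s).
Proof. exact: (@submoduleD R R^o). Qed.

Lemma idealB I r s : ideal I -> I r -> I s -> I (r - s).
Proof. exact: (@submoduleB R R^o). Qed.

Lemma ideal_subl I r s : ideal I -> I (r - s) -> I s -> I r.
Proof. exact: (@submodule_subl R R^o). Qed.

Lemma ideal_maximal (F : set (set R)) I0 : noetherian R^o ->
    (forall I, F I -> ideal I) -> F I0 ->
  exists I, [/\ F I, I0 `<=` I & forall I', F I' -> I `<=` I' -> I' `<=` I].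
Proof. exact: (@noetherian_maximal R R^o). Qed.

Lemma prime_notM P : prime_ideal P -> forall s t, ~ P s -> ~ P t -> ~ P (s * t).
Proof. by move=> [_ _ PM] s t Ps Pt /PM []. Qed.

Lemma proper_maximal_prime P : proper_maximal P -> prime_ideal P.
Proof.
move=> [iP P1 Pmax]; split=> // a b Pab; apply: contrapT => /not_orP[Pa Pb].
have [u Pu] := Pmax _ Pa; apply: Pb.
have -> : b = (1 - u * a) * b + u * (a * b).
  by rewrite mulrBl mul1r mulrA subrK.
by apply: idealD => //; [apply: ideal_mulr | apply: ideal_mull].
Qed.

Lemma prime_bigcap P n (F : nat -> set R) : prime_ideal P ->
    (forall i, ideal (F i)) -> \bigcap_(i in `I_n) F i `<=` P ->
  exists2 i, (i < n)%N & F i `<=` P.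
Proof.
move=> [iP P1 PM] iF; elim: n => [h|n IH h].
  by case: P1; apply: h => i; rewrite /= ltn0.
case: (pselect (F n `<=` P)) => [|nFP]; first by exists n.
have [|i i_n FiP] := IH; last by exists i => //; apply: ltnW.
have /existsNP[b /not_implyP[Fb Pb]] := nFP.
move=> a Fa; case: (PM a b) => //; apply: h => i /=.
rewrite ltnS leq_eqVlt => /orP[/eqP->|i_n]; first exact: ideal_mull.
by apply: ideal_mulr => //; apply: Fa.
Qed.

(** An ideal maximal among those that contain [I] and avoid [S] is prime: if two
    elements outside it had their product in it, adjoining either would meet
    [S], and so would their product. *)
Lemma exists_prime_avoiding I S : noetherian R^o -> ideal I -> S 1 ->
    (forall s t, S s -> S t -> S (s * t)) -> (forall s, S s -> ~ I s) ->
  exists P, [/\ prime_ideal P, I `<=` P & forall s, S s -> ~ P s].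
Proof.
move=> noethR iI S1 SM SI.
pose F J := ideal J /\ (forall s, S s -> ~ J s).
have [||P [[iP SP] IP Pmax]] := ideal_maximal (F := F) (I0 := I) noethR _ _.
- by move=> J [].
- by [].
exists P; split=> //; split=> // [|a b Pab]; first exact: SP.
apply: contrapT => /not_orP[Pa Pb].
have meets c : ~ P c -> exists2 s, S s & @adjoin R R^o P c s.
  move=> Pc; apply: contrapT => h; apply/Pc/(Pmax (@adjoin R R^o P c)).
  - by split=> [|s Ss Ps]; [apply: submodule_adjoin | apply: h; exists s].
  - exact: (@sub_adjoin R R^o).
  - exact: (@adjoin_mem R R^o).
have [s Ss [c Psc]] := meets a Pa; have [t St [d Ptd]] := meets b Pb.
apply: (SP (s * t) (SM _ _ Ss St)).
have -> : s * t = (s - c * a) * t + (c * a) * (t - d * b) + (c * d) * (a * b).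
  by rewrite mulrBl mulrBr [c * d * _]mulrACA addrA subrK subrK.
do ?apply: idealD => //.
- exact: ideal_mulr.
- exact: ideal_mull.
- exact: ideal_mull.
Qed.

End Ideals.

(** * Chain conditions at a prime *)

Section LocalChains.
Variables (R : comNzRingType) (V : lmodType R) (P : set R).
Hypotheses (noethV : noetherian V) (primeP : prime_ideal P).
Implicit Types (N L T U : set V).

Let PM := prime_notM primeP.
Let P1 : ~ P 1. Proof. by case: primeP. Qed.

(** If [V] is localized at [P], the hypothesis on [T / U] says that every nonzero
    quotient of it contains a copy of the residue field of [P], so that [T / U]
    has finite length.  Rather than measuring lengths, one takes [N] maximal
    such that the traces of the chain on [N] become constant.  Enlarging [N] by a
    residue field keeps this property, since the image of a trace in a
    one-dimensional space is zero or everything. *)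
Lemma descending_chain_stops T U (W : nat -> set V) :
    submodule T -> submodule U -> saturated P T U ->
    (forall n, [/\ submodule (W n), saturated P T (W n), U `<=` W n & W n `<=` T]) ->
    (forall n, W n.+1 `<=` W n) ->
    (forall N, submodule N -> saturated P T N -> U `<=` N -> N `<=` T ->
       ~ T `<=` N -> exists v, [/\ T v, ~ N v & forall r, P r -> N (r *: v)]) ->
  exists n, W n `<=` W n.+1.
Proof.
move=> sT sU satU WP Wdec residue.
have Wle m n : (m <= n)%N -> W n `<=` W m.
  move=> /subnK <-; elim: (n - m)%N => [//|k IH].
  by apply: subset_trans IH; apply: Wdec.
pose F N := [/\ submodule N, saturated P T N, U `<=` N, N `<=` T &
  exists n0, forall n, (n0 <= n)%N -> W n0 `&` N `<=` W n].
have [||N [[sN satN UN NT [n0 n0P]] _ Nmax]] :=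
  noetherian_maximal (F := F) (N0 := U) noethV _ _.
- by move=> N [].
- split=> //; first by case: (WP 0%N) => _ _ UW WT; apply: subset_trans UW WT.
  by exists 0%N => n _ u [_ Uu]; case: (WP n) => _ _ + _; apply.
case: (pselect (T `<=` N)) => [TN|/(residue N sN satN UN NT) [v [Tv Nv PvN]]].
  exists n0 => u Wu; apply: (n0P n0.+1) => //; split=> //.
  by apply: TN; case: (WP n0) => _ _ _; apply.
case: Nv; pose N' := T `&` saturation P (adjoin N v).
have sN' : submodule N'.
  by apply: submoduleI => //; apply: submodule_saturation => //; apply: submodule_adjoin.
apply: (Nmax N'); last 2 first.
- move=> u Nu; split; first exact: NT.
  by apply: sub_saturation => //; apply: sub_adjoin.
- by split=> //; apply: sub_saturation => //; apply: adjoin_mem.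
have NN' : N `<=` N'.
  move=> u Nu; split; first exact: NT.
  by apply: sub_saturation => //; apply: sub_adjoin.
split=> //; first 3 last.
- case: (pselect (exists2 n1, (n0 <= n1)%N & W n1 `&` N' `<=` N)).
    move=> [n1 n01 n1N]; exists n1 => n n1n z Wz.
    apply: (n0P n); first exact: leq_trans n1n.
    by split; [apply: (Wle _ _ n01); case: Wz | apply: n1N].
  move=> noN; exists n0 => n n0n z [Wz [Tz [s Ps [b Nsz]]]].
  have /existsNP[w /not_implyP[[Ww [Tw [s' Ps' [b' Nsw]]]] nNw]] : ~ W n `&` N' `<=` N.
    by move=> h; apply: noN; exists n.
  have Pb' : ~ P b'.
    move=> /PvN Nb'v; apply: nNw; apply: (satN s') => //.
    exact: submodule_subl Nb'v.
  have [sW satW _ _] := WP n; have [sW0 _ _ _] := WP n0.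
  apply: (satW (b' * s)) => //; first exact: PM.
  apply: (@submodule_subl _ _ _ _ ((b * s') *: w)) => //; last exact: submoduleZ.
  apply: (n0P n) => //; split.
    by apply: submoduleB => //; apply: submoduleZ => //; apply: (Wle _ _ n0n).
  have -> : (b' * s) *: z - (b * s') *: w =
      b' *: (s *: z - b *: v) - b *: (s' *: w - b' *: v).
    by rewrite !scalerBr !scalerA opprB addrA [b * b']mulrC subrK.
  by apply: submoduleB => //; apply: submoduleZ.
- move=> s u Ps Tu [_ satu]; split=> //.
  exact: (saturation_saturated (T := T) (N := adjoin N v) PM) satu.
- exact: subset_trans UN NN'.
- by move=> u [].
Qed.

(** Nakayama's lemma for [I / L] localized at [P]: otherwise a quotient of it
    would be simple, and [x] would act on it both as zero and surjectively. *)
Lemma local_nakayama (x : R) L I : P x -> submodule L -> submodule I ->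
    saturated P setT L -> saturated P setT I -> L `<=` I ->
    (forall u, I u -> exists2 s, ~ P s & exists2 t, I t & L (s *: u - x *: t)) ->
  I `<=` L.
Proof.
move=> Px sL sI satL satI LI xI; apply: contrapT => nIL.
pose F N := [/\ submodule N, saturated P setT N, N `<=` I & ~ I `<=` N].
have [||N [[sN satN NI nIN] LN Nmax]] :=
  noetherian_maximal (F := F) (N0 := L) noethV _ _.
- by move=> N [].
- by [].
(* The quotient of [I] by [N] is simple: any [w] outside [N] generates it. *)
have gen w : I w -> ~ N w -> I `<=` saturation P (adjoin N w).
  move=> Iw nNw; apply: contrapT => nI; apply: nNw.
  apply: (Nmax (saturation P (adjoin N w))); last 2 first.
  - by apply: subset_trans (sub_adjoin _) _; apply: sub_saturation.
  - by apply: sub_saturation => //; apply: adjoin_mem.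
  split=> //.
  - by apply: submodule_saturation => //; apply: submodule_adjoin.
  - exact: saturation_saturated.
  - apply: saturation_sub => // u [c Nu].
    by apply: (submodule_subl sI (NI _ Nu)); apply: submoduleZ.
have [v [Iv nNv]] : exists v, I v /\ ~ N v.
  by have /existsNP[v /not_implyP] := nIN; exists v.
have iP : ideal P by case: primeP.
have Nxv : N (x *: v).
  apply: contrapT => nNxv.
  have [s Ps [b Nb]] := gen _ (submoduleZ x sI Iv) nNxv _ Iv.
  apply: nNv; apply: (satN (s - b * x)) => //; last by rewrite scalerBl -scalerA.
  move=> Psb; apply: Ps; apply: (ideal_subl iP Psb).
  exact: ideal_mull.
have [s Ps [t It Lst]] := xI v Iv.
have [s' Ps' [b Ntb]] := gen v Iv nNv _ It.
apply: nNv; apply: (satN s) => //; apply: (submodule_subl sN (LN _ Lst)).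
apply: (satN s') => //; rewrite scalerA mulrC -scalerA.
have -> : s' *: t = (s' *: t - b *: v) + b *: v by rewrite subrK.
rewrite scalerDr; apply: submoduleD => //; first exact: submoduleZ.
by rewrite scalerA mulrC -scalerA; apply: submoduleZ.
Qed.

End LocalChains.

(** * Krull's height theorem *)

Section Height.
Variable R : comNzRingType.
Hypothesis noethR : noetherian R^o.
Implicit Types (I P Q : set R) (x y : R).

(** Krull's principal ideal theorem, relative to [P0]: a prime minimal over
    [P0 + (x)] has height at most one over [P0].  Given [y] in [Q] but not in
    [P0], the ideals [J n = (P0 + (y^n) : x^oo)], localized at [P], satisfy
    [J n <= J n.+1 + (x)] for some [n], because [P] is the only prime of the local
    ring at [P] that contains [P0 + (x)].  The colon by powers of [x] improves
    this to [J n <= J n.+1 + x J n], so [J n = J n.+1] by Nakayama.  But then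
    [y^n] belongs to [J n.+1], which forces a power of [x] into [Q]. *)
Lemma no_prime_between P0 Q P x :
    prime_ideal P0 -> prime_ideal Q -> prime_ideal P -> P0 `<` Q -> Q `<` P -> P x ->
    (forall P', prime_ideal P' -> P0 `<=` P' -> P' `<=` P -> P' x -> P `<=` P') ->
  False.
Proof.
move=> prP0 prQ prP [P0Q nQP0] [QP nPQ] Px Pmin.
have [iP0 P01 P0M] := prP0; have [iQ Q1 QM] := prQ; have [iP P1 _] := prP.
have PM := prime_notM prP.
have nQx : ~ Q x by move=> /(Pmin Q prQ P0Q QP).
have [y [Qy nP0y]] : exists y, Q y /\ ~ P0 y.
  by have /existsNP[y /not_implyP] := nQP0; exists y.
pose J n := [set r | exists k s a, ~ P s /\ P0 (s * x ^+ k * r - a * y ^+ n)].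
have iJ n : ideal (J n).
  split=> [|c u v [k [s [a [Ps P0u]]]] [l [t [b [Pt P0v]]]]].
    by exists 0%N, 1, 0; split=> //; rewrite mulr0 mul0r subrr; apply: submodule0 iP0.
  exists (k + l)%N, (s * t), (c * (t * x ^+ l) * a + (s * x ^+ k) * b).
  split; first exact: PM.
  have -> : s * t * x ^+ (k + l) * (c * u + v) -
      (c * (t * x ^+ l) * a + s * x ^+ k * b) * y ^+ n =
      c * (t * x ^+ l) * (s * x ^+ k * u - a * y ^+ n) +
      (s * x ^+ k) * (t * x ^+ l * v - b * y ^+ n).
    rewrite exprD [s * t * _]mulrACA.
    move: (s * x ^+ k) (t * x ^+ l) => e f.
    rewrite mulrDr mulrDl opprD addrACA !mulrBr !mulrA; congr (_ * _ - _ + _).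
    by rewrite mulrC [e * f]mulrC mulrA.
  by apply: idealD => //; apply: ideal_mull.
have satJ n : @saturated R R^o P setT (J n).
  move=> s u Ps _ [k [t [a [Pt P0u]]]]; exists k, (t * s), a; split; first exact: PM.
  by rewrite -[t * s * _]mulrA [s * _]mulrC !mulrA -[_ * s * u]mulrA.
have xJ n c : J n (c * x) -> J n c.
  move=> [k [s [a [Ps P0c]]]]; exists k.+1, s, a; split=> //.
  by rewrite exprSr mulrA -[_ * x * c]mulrA [x * c]mulrC.
have P0J n : P0 `<=` J n.
  move=> r P0r; exists 0%N, 1, 0; split=> //.
  by rewrite mulr1 mul1r mul0r subr0.
have Jdec n : J n.+1 `<=` J n.
  move=> r [k [s [a [Ps P0r]]]]; exists k, s, (a * y); split=> //.
  by rewrite -[a * y * _]mulrA -exprS.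
pose W n := saturation P (@adjoin R R^o (J n) x).
pose U := saturation P (@adjoin R R^o P0 x).
have sW I : ideal I -> ideal (saturation P (@adjoin R R^o I x)).
  by move=> iI; apply: submodule_saturation => //; apply: submodule_adjoin.
have mono I I' : I `<=` I' ->
    saturation P (@adjoin R R^o I x) `<=` saturation P (@adjoin R R^o I' x).
  by move=> II' u [s Ps [c Ic]]; exists s => //; exists c; apply: II'.
have subsat I : I `<=` saturation P (@adjoin R R^o I x).
  apply: subset_trans (@sub_adjoin R R^o I x) _.
  exact: (@sub_saturation R R^o).
have [n Wn] : exists n, W n `<=` W n.+1.
  apply: (@descending_chain_stops R R^o P noethR prP setT U W) => //.
  - exact: sW.
  - exact: saturation_saturated.
  - move=> n; split=> //; first exact: sW.
      exact: saturation_saturated.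
    exact: mono.
  - by move=> n; apply: mono.
  move=> N iN satN UN _ nN.
  have N1 : ~ N 1 by move=> N1; apply: nN => r _; rewrite -[r]mulr1; apply: ideal_mull.
  (* [Q'] is an associated prime of [R / N], so it lies between [P0 + (x)] and
     [P] and is equal to [P]: then [v] generates a copy of the residue field. *)
  have [||Q' [[v nNv Q'E] _ Q'max]] :=
    @ideal_maximal R [set Q' | exists2 v, ~ N v & Q' = [set r | N (r * v)]]
      [set r | N (r * 1)] noethR.
  - move=> _ [v _ ->]; split; first by rewrite /= mul0r; apply: submodule0 iN.
    by move=> a r s Nr Ns; rewrite /= mulrDl -[_ *: _ * v]mulrA; case: iN => _; apply.
  - by exists 1.
  have prQ' : prime_ideal Q'.
    split.
    - rewrite Q'E; split; first by rewrite /= mul0r; apply: submodule0 iN.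
      by move=> a r s Nr Ns; rewrite /= mulrDl -[_ *: _ * v]mulrA; case: iN => _; apply.
    - by rewrite Q'E /= mul1r.
    - move=> a b; rewrite Q'E /= => Nab; case: (pselect (N (b * v))); first by right.
      move=> nNbv; left; have := Q'max [set r | N (r * (b * v))].
      rewrite Q'E; apply; first by exists (b * v).
        by move=> r Nr; rewrite /= mulrCA; apply: ideal_mull.
      by rewrite /= mulrA.
  exists v; split=> // r Pr; suff : Q' r by rewrite Q'E.
  apply: (Pmin Q') => //.
  - by move=> z P0z; rewrite Q'E /= mulrC; apply: ideal_mull => //; apply/UN/subsat.
  - move=> z; rewrite Q'E /= => Nzv; apply: contrapT => nPz; apply: nNv.
    exact: (satN z).
  - rewrite Q'E /= mulrC; apply: ideal_mull => //; apply: UN.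
    by apply: (@sub_saturation R R^o) => //; apply: (@adjoin_mem R R^o).
have JJ : J n `<=` J n.+1.
  apply: (@local_nakayama R R^o P noethR prP x) => //; [exact: iJ | exact: iJ |].
  move=> u Ju; have [s Ps [c Jc]] := Wn u (subsat _ u Ju).
  exists s => //; exists c; last by rewrite -[x *: (c : R^o)]/(x * c : R) mulrC.
  apply: xJ; have -> : c * x = s * u - (s * u - c * x) by rewrite opprB addrC subrK.
  by apply: (idealB (iJ n)); [apply: ideal_mull (iJ n) Ju | apply: Jdec].
have : J n.+1 (y ^+ n).
  by apply: JJ; exists 0%N, 1, 1; split=> //; rewrite mulr1 subrr; apply: submodule0 iP0.
move=> [k [s [a [Ps]]]]; rewrite exprS mulrA -mulrBl => /P0M [|P0yn].
  move=> /P0Q Qs; have : Q (s * x ^+ k).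
    apply: (ideal_subl iQ Qs); exact: ideal_mull.
  have Qs' : ~ Q s by move=> /QP.
  elim: k {Qs} => [|k IH]; first by rewrite mulr1.
  by rewrite exprSr mulrA => /QM [].
elim: n P0yn {Wn JJ} => [|n IH]; first exact: P01.
by rewrite exprS => /P0M [].
Qed.

Fixpoint chain_below (k : nat) P : Prop :=
  if k is k'.+1 then exists2 P', prime_ideal P' /\ P' `<` P & chain_below k' P'
  else True.

Lemma chain_below_le P Q k : P `<=` Q -> chain_below k P -> chain_below k Q.
Proof.
case: k => [|k] //= PQ [P' [prP' [P'P nPP']] P'k]; exists P' => //; split=> //.
by split; [apply: subset_trans PQ | move=> QP'; apply/nPP'/(subset_trans PQ)].
Qed.

Lemma chain_belowW P k l : (k <= l)%N -> chain_below l P -> chain_below k P.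
Proof.
elim: k l P => [|k IH] [|l] P //; rewrite ltnS => kl [P' hP' P'l].
by exists P' => //; apply: IH P'l.
Qed.

(** If [P] is minimal over [I], then [y] becomes nilpotent in the localization of
    [R / I] at [P]: otherwise some prime between [I] and [P] avoids [y]. *)
Lemma prime_minimal_witness P I y : prime_ideal P -> ideal I -> P y ->
    (forall P', prime_ideal P' -> I `<=` P' -> P' `<=` P -> P `<=` P') ->
  exists s t, ~ P s /\ I (s * y ^+ t).
Proof.
move=> prP iI Py Pmin; apply: contrapT => h; have [_ P1 _] := prP.
have PM := prime_notM prP.
have [|||P' [prP' IP' avoid]] := @exists_prime_avoiding R I
  [set z | exists s t, ~ P s /\ z = s * y ^+ t] noethR iI.
- by exists 1, 0%N; split=> //; rewrite mulr1.
- move=> _ _ [s [t [Ps ->]]] [s' [t' [Ps' ->]]]; exists (s * s'), (t + t')%N.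
  by split; [apply: PM | rewrite mulrACA exprD].
- by move=> _ [s [t [Ps ->]]] Is; apply: h; exists s, t.
apply: (avoid y); first by exists 1, 1%N; split=> //; rewrite mul1r.
apply: (Pmin P') => // z P'z; apply: contrapT => nPz; apply: (avoid z) => //.
by exists z, 0%N; split=> //; rewrite mulr1.
Qed.

(** Krull's height theorem.  If [P1] is a prime just below [P] and [x] is a generator
    outside it, then modulo [x], and up to localization at [P] and powers, the
    other generators can be moved into [P1]; by the principal ideal theorem
    [P1] is minimal over the elements so obtained. *)
Lemma height_le_generators (xs : seq R) P : prime_ideal P ->
    {in xs, forall x, P x} ->
    (forall P', prime_ideal P' -> {in xs, forall x, P' x} -> P' `<=` P -> P `<=` P') ->
  ~ chain_below (size xs).+1 P.
Proof.
move: {2}(size xs) (erefl (size xs)) => n; elim: n xs P => [|n IH] xs P.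
  move=> /size0nil -> prP _ Pmin [P' [prP' [P'P nPP']] _].
  by apply: nPP'; apply: Pmin.
move=> sz prP Pxs Pmin; rewrite sz => -[P2 [prP2 [P2P nPP2]] P2n].
have [||P1 [[prP1 [P1P nPP1]] P21 P1max]] :=
  @ideal_maximal R [set Q | prime_ideal Q /\ Q `<` P] P2 noethR.
- by move=> Q [[]].
- by split.
have {P2n} P1n := @chain_below_le P2 P1 n.+1 P21 P2n.
have [x xsx nP1x] : exists2 x, x \in xs & ~ P1 x.
  apply: contrapT => h; apply: nPP1; apply: Pmin => // x xsx.
  by apply: contrapT => nP1x; apply: h; exists x.
have Px := Pxs x xsx.
have [iP1 _ _] := prP1.
have above Q : prime_ideal Q -> P1 `<=` Q -> Q `<=` P -> Q x -> P `<=` Q.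
  move=> prQ P1Q QP Qx; apply: contrapT => nPQ.
  by apply: nP1x; apply: (P1max Q).
have [f fP] : {f : R -> R & forall y, y \in xs ->
    [/\ P1 (f y) & exists s t a, ~ P s /\ s * y ^+ t = f y + a * x]}.
  apply: (@boolp.choice _ _ (fun y z => y \in xs -> [/\ P1 z &
    exists s t a, ~ P s /\ s * y ^+ t = z + a * x])) => y.
  case: (boolP (y \in xs)) => [xsy|_]; last by exists 0.
  have [||||s [t [Ps [a P1a]]]] := @prime_minimal_witness P (@adjoin R R^o P1 x) y.
  - exact: prP.
  - exact: submodule_adjoin.
  - exact: Pxs.
  - move=> Q prQ P1Q QP; apply: above => //.
      exact: subset_trans (@sub_adjoin R R^o _ _) P1Q.
    by apply: P1Q; apply: (@adjoin_mem R R^o).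
  exists (s * y ^+ t - a * x) => _; split=> //.
  by exists s, t, a; split=> //; rewrite subrK.
have szr : size (map f (rem x xs)) = n by rewrite size_map size_rem // sz.
apply: (IH (map f (rem x xs)) P1 szr prP1); last by rewrite szr.
  by move=> _ /mapP[y /mem_rem xsy ->]; have [] := fP y xsy.
move=> Q prQ Qf QP1; apply: contrapT => nP1Q.
apply: (@no_prime_between Q P1 P x) => // P' prP' QP' P'P P'x.
have [iP' _ P'M] := prP'.
apply: Pmin => // y xsy.
case: (eqVneq y x) => [-> //|yx].
have [_ [s [t [a [Ps e]]]]] := fP y xsy.
have : P' (s * y ^+ t).
  rewrite e; apply: idealD => //; last exact: ideal_mull.
  by apply/QP'/Qf/map_f/rem_mem.
case/P'M => [/P'P //|]; elim: t {e} => [|t IHt]; first by case: prP'.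
by rewrite exprS => /P'M [].
Qed.

(** Generators are described through the ideals that contain them, which avoids
    linear combinations. *)
Lemma ideal_finitely_generated I : ideal I ->
  exists2 xs : seq R, {in xs, forall x, I x} &
    forall J, ideal J -> {in xs, forall x, J x} -> I `<=` J.
Proof.
move=> iI.
pose gen (xs : seq R) := \bigcap_(J in [set J | ideal J /\ {in xs, forall x, J x}]) J.
have igen xs : ideal (gen xs) by apply: submodule_bigcap => J [].
have [||_ [[xs Ixs <-] _ xsmax]] :=
  @ideal_maximal R [set gen xs | xs in [set xs : seq R | {in xs, forall x, I x}]]
    (gen [::]) noethR.
- by move=> _ [xs _ <-].
- by exists [::].
exists xs => // J iJ Jxs r Ir; suff : gen xs r by apply.
apply: (xsmax (gen (r :: xs))); last by move=> K [_ Kr]; apply: Kr; rewrite mem_head.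
- by exists (r :: xs) => // z; rewrite inE => /orP[/eqP->|/Ixs].
- move=> z zgen K [iK Kr]; apply: zgen; split=> // w xsw.
  by apply: Kr; rewrite inE xsw orbT.
Qed.

Lemma prime_finite_height P : prime_ideal P -> exists n, ~ chain_below n P.
Proof.
move=> prP; have [iP _ _] := prP; have [xs Pxs xsP] := ideal_finitely_generated iP.
exists (size xs).+1; apply: height_le_generators => // P' [iP' _ _] P'xs _.
exact: xsP.
Qed.

Fixpoint chain_above (F : set (set R)) (k : nat) P : Prop :=
  if k is k'.+1 then exists2 P', F P' /\ P `<` P' & chain_above F k' P' else True.

Lemma chain_above_below (F : set (set R)) k l P : F `<=` @prime_ideal R -> F P ->
  chain_above F k P -> chain_below l P -> exists2 P', F P' & chain_below (k + l) P'.
Proof.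
move=> prF; elim: k l P => [|k IH] l P FP; first by exists P.
move=> [P' [FP' PP'] P'k] Pl; rewrite addSnnS; apply: (IH _ P') => //.
by exists P => //; split=> //; apply: prF.
Qed.

Lemma chain_above_le (F : set (set R)) P Q k :
  P `<=` Q -> chain_above F k Q -> chain_above F k P.
Proof.
case: k => [|k] //= PQ [P' [FP' [QP' nP'Q]] P'k]; exists P' => //; split=> //.
by split; [apply: subset_trans QP' | move=> P'P; apply/nP'Q/(subset_trans P'P)].
Qed.

(** Every chain of primes extends to a maximal ideal, whose height is finite. *)
Lemma semilocal_finite_dimension : finite_set [set m : set R | proper_maximal m] ->
  exists n, forall F P, F `<=` @prime_ideal R -> F P -> ~ chain_above F n P.
Proof.
move=> finM.
have [h hP] : {h : set R -> nat & forall m, proper_maximal m -> ~ chain_below (h m) m}.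
  apply: (@boolp.choice _ _ (fun m n => proper_maximal m -> ~ chain_below n m)) => m.
  case: (pselect (proper_maximal m)) => [mm|nm]; last by exists 0%N => /nm.
  by have [n hn] := prime_finite_height (proper_maximal_prime mm); exists n.
have /finite_seqP[s sE] := finite_image h finM.
exists (\max_(n <- s) n) => F P prF FP Pn.
have [Q FQ] := chain_above_below prF FP Pn (l := 0) I.
rewrite addn0 => Qn; have [iQ Q1 _] := prF Q FQ.
have [||m [[im m1] Qm mmax]] :=
  @ideal_maximal R [set I | ideal I /\ ~ I 1] Q noethR.
- by move=> I [].
- by split.
have mm : proper_maximal m.
  split=> // r nmr; apply: contrapT => h1; apply: nmr.
  apply: (mmax (@adjoin R R^o m r)); last exact: (@adjoin_mem R R^o).
    by split; [apply: submodule_adjoin | move=> [c mc]; apply: h1; exists c].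
  exact: (@sub_adjoin R R^o).
apply: (hP m mm); apply: chain_below_le Qm _; apply: chain_belowW Qn.
have : [set` s] (h m) by rewrite -sE; exists m.
by move=> hs; apply: (leq_bigmax_seq _ hs isT).
Qed.

End Height.

(** * Cartier submodules and their special primes *)

Section Cartier.
Variables (R : comNzRingType) (V : lmodType R) (p : nat) (phi : V -> V).
Hypotheses (p_gt1 : (1 < p)%N)
  (phiD : forall u v, phi (u + v) = phi u + phi v)
  (phiZ : forall r v, phi (r ^+ p *: v) = r *: phi v)
  (phi_surj : forall v, exists w, v = phi w)
  (noethR : noetherian R^o) (noethV : noetherian V).
Implicit Types (N L T : set V) (A Q b m : set R).

Definition cartier N : Prop := submodule N /\ forall v, N v -> N (phi v).

Definition quotient_ann N : set R := [set r | forall v, N (r *: v)].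

Definition special b : Prop := exists2 N, cartier N & b = quotient_ann N.

Definition special_prime : set (set R) := [set Q | prime_ideal Q /\ special Q].

Lemma special_ideal b : special b -> ideal b.
Proof.
move=> [N [sN _] ->]; split=> [v|a r s Nr Ns v].
  by rewrite scale0r; apply: submodule0.
by rewrite scalerDl -scalerA; apply: submoduleD => //; apply: submoduleZ.
Qed.

(** Since [r v = r (phi w) = phi (r^p w)], a special ideal that contains
    [r^p] contains [r]. *)
Lemma special_radical b r : special b -> b (r * r) -> b r.
Proof.
move=> [N [sN phiN] ->] Nrr v; have [w ->] := phi_surj v.
rewrite -phiZ; apply: phiN; rewrite -(subnK p_gt1) exprD expr2 -scalerA.
exact: submoduleZ.
Qed.

Lemma special_colon A b : special b -> special [set r | forall a, A a -> b (r * a)].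
Proof.
move=> [N [sN phiN] ->]; exists [set v | forall a, A a -> N (a *: v)]; last first.
  apply/seteqP; split=> r h v => [a Aa|a Aa]; last by rewrite mulrC -scalerA; apply: h.
  by rewrite scalerA mulrC; apply: h.
split; first split.
- by move=> a Aa; rewrite scaler0; apply: submodule0.
- move=> c u v Nu Nv a Aa; rewrite scalerDr scalerA mulrC -scalerA.
  by apply: submoduleD; [|apply: submoduleZ => //; apply: Nu|apply: Nv].
move=> v Nv a Aa; rewrite -phiZ; apply: phiN.
rewrite -(subnK (ltnW p_gt1)) exprD expr1 -scalerA.
by apply: submoduleZ => //; apply: Nv.
Qed.

(** A special ideal maximal among those that avoid [a] is prime: replace it by
    its colon by [r] or by [a] and use that special ideals are radical. *)
Lemma special_prime_avoiding b a : special b -> ~ b a ->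
  exists Q, [/\ special_prime Q, b `<=` Q & ~ Q a].
Proof.
move=> spb nba.
have [||Q [[spQ nQa] bQ Qmax]] :=
  @ideal_maximal R [set Q | special Q /\ ~ Q a] b noethR.
- by move=> Q [/special_ideal].
- by split.
have iQ := special_ideal spQ.
have colon c : Q `<=` [set r | forall d, [set c] d -> Q (r * d)].
  move=> r Qr _ ->. exact: ideal_mulr.
exists Q; split=> //; split=> //; split=> // [Q1|r s Qrs].
  by apply: nQa; rewrite -[a]mulr1; apply: ideal_mull.
case: (pselect (Q (a * r))) => [Qar|nQar].
  left; apply: (Qmax [set r | forall d, [set a] d -> Q (r * d)]) => //.
    split; first exact: special_colon.
    by move=> /(_ a erefl) Qaa; exact: nQa (special_radical spQ Qaa).
  by move=> _ ->; rewrite mulrC.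
right; apply: (Qmax [set s | forall d, [set r] d -> Q (s * d)]) => //.
  by split; [apply: special_colon | move=> /(_ r erefl)].
by move=> _ ->; rewrite mulrC.
Qed.

Lemma cartierI N L : cartier N -> cartier L -> cartier (N `&` L).
Proof.
move=> [sN phiN] [sL phiL]; split; first exact: submoduleI.
by move=> v [Nv Lv]; split; [apply: phiN | apply: phiL].
Qed.

Lemma cartier_bigcap I (D : set I) (F : I -> set V) :
  (forall i, D i -> cartier (F i)) -> cartier (\bigcap_(i in D) F i).
Proof.
move=> cF; split; first by apply: submodule_bigcap => i /cF [].
by move=> v Fv i Di; apply: (cF i Di).2; apply: Fv.
Qed.

Lemma cartier_sum N L :
  cartier N -> cartier L -> cartier [set v | exists2 w, L w & N (v - w)].
Proof.
move=> [sN phiN] [sL phiL]; split; first split.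
- by exists 0; rewrite ?subr0; apply: submodule0.
- move=> a u v [w Lw Nuw] [z Lz Nvz]; exists (a *: w + z).
    by apply: submoduleD => //; apply: submoduleZ.
  rewrite opprD addrACA -scalerBr.
  by apply: submoduleD => //; apply: submoduleZ.
move=> v [w Lw Nvw]; exists (phi w); first exact: phiL.
have -> : phi v - phi w = phi (v - w) by apply/eqP; rewrite subr_eq -phiD subrK.
exact: phiN.
Qed.

(** The Cartier submodule generated by [A V]. *)
Definition cartier_hull A : set V :=
  \bigcap_(N in [set N | cartier N /\ forall a v, A a -> N (a *: v)]) N.

Lemma cartier_cartier_hull A : cartier (cartier_hull A).
Proof. by apply: cartier_bigcap => N []. Qed.

Lemma cartier_hull_mem A a v : A a -> cartier_hull A (a *: v).
Proof. by move=> Aa N [_]; apply. Qed.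

Lemma cartier_hull_sub A N :
  cartier N -> (forall a v, A a -> N (a *: v)) -> cartier_hull A `<=` N.
Proof. by move=> cN AN v; apply. Qed.

Definition maximal_special_prime A : set (set R) :=
  [set Q | [/\ special_prime Q, ~ A `<=` Q &
    forall Q', special_prime Q' -> ~ A `<=` Q' -> Q `<=` Q' -> Q' `<=` Q]].

(** Comaximality: [N n] and the intersection of the earlier [N i] together span
    the Cartier submodule [T] generated by [A V].  Otherwise some special prime
    that does not contain [A] contains both [Q n] and the intersection of the
    earlier [Q i], against the maximality of all of these. *)
Lemma maximal_special_comaximal A (Q : nat -> set R) (N : nat -> set V) n L :
    (forall i, maximal_special_prime A (Q i)) -> injective Q ->
    (forall i, cartier (N i) /\ Q i = quotient_ann (N i)) ->
    submodule L -> cartier_hull A `&` N n `<=` L ->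
    cartier_hull A `&` \bigcap_(i in `I_n) N i `<=` L -> cartier_hull A `<=` L.
Proof.
move=> maxQ injQ NP sL NL IL.
pose T := cartier_hull A.
have cT : cartier T := cartier_cartier_hull A.
pose I := T `&` \bigcap_(i in `I_n) N i.
have cI : cartier I.
  by apply: cartierI => //; apply: cartier_bigcap => i _; case: (NP i).
have cN : cartier (T `&` N n) by apply: cartierI => //; case: (NP n).
have cK := cartier_sum cN cI.
pose K := [set v | exists2 w, I w & (T `&` N n) (v - w)].
have KL : K `<=` L.
  by move=> v [w Iw Nvw]; apply: (submodule_subl sL (NL _ Nvw)); apply: IL.
apply: subset_trans KL; apply: cartier_hull_sub => // a v Aa.
have sK : submodule K by case: cK.
suff h : quotient_ann K a by apply: h.
apply: contrapT => nKa.
have spK : special (quotient_ann K) by exists K.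
(* The colon by [a] contains [Q n] and the intersection of the earlier [Q i],
   but it avoids [a] because special ideals are radical. *)
have spC := special_colon [set a] spK.
have [|Q' [spQ' CQ' nQ'a]] := special_prime_avoiding spC (a := a).
  by move=> /(_ a erefl) Kaa; exact: nKa (special_radical spK Kaa).
have nAQ' : ~ A `<=` Q' by move=> /(_ a Aa).
have QQ' : Q n `<=` Q'.
  move=> r Qr; apply: CQ' => _ -> w; exists 0; first by apply: submodule0; case: cI.
  rewrite subr0 -scalerA; split.
    by apply: (submoduleZ (N := T)); [case: cT | apply: cartier_hull_mem].
  by move: Qr; rewrite (NP n).2 => Qr; apply: Qr.
have [_ _ Qnmax] := maxQ n; have Q'Q := Qnmax Q' spQ' nAQ' QQ'.
have [[prQn spQn] nAQn _] := maxQ n.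
have [||i i_n QiQ] := @prime_bigcap R (Q n) n Q prQn _ _.
- by move=> i; case: (maxQ i) => -[[]].
- apply: subset_trans Q'Q => r Qr; apply: CQ' => _ -> w; exists ((r * a) *: w).
    split.
      rewrite -scalerA; apply: (submoduleZ (N := T)); first by case: cT.
      exact: cartier_hull_mem.
    move=> i i_n; have := Qr i i_n; rewrite (NP i).2 -scalerA => h; apply: h.
  by rewrite subrr; apply: submodule0; case: cN.
have [_ _ Qimax] := maxQ i; have QQi := Qimax (Q n) (conj prQn spQn) nAQn QiQ.
have /injQ e : Q i = Q n by apply/seteqP; split.
by move: i_n; rewrite e /= ltnn.
Qed.

(** [T / L'] is simple, hence isomorphic to [R] modulo the annihilator in the last
    clause. *)
Lemma exists_maximal_above L T : submodule L -> submodule T -> L `<=` T -> ~ T `<=` L ->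
  exists L', [/\ submodule L', L `<=` L', L' `<=` T, ~ T `<=` L' &
    proper_maximal [set r | forall v, T v -> L' (r *: v)]].
Proof.
move=> sL sT LT nTL.
have [||L' [[sL' L'T nTL'] LL' Lmax]] := noetherian_maximal
  (F := [set L' | [/\ submodule L', L' `<=` T & ~ T `<=` L']]) (N0 := L) noethV _ _.
- by move=> N [].
- by split.
exists L'; split=> //; split; first split.
- by move=> v Tv; rewrite scale0r; apply: submodule0.
- move=> a r s Nr Ns v Tv; rewrite scalerDl -scalerA.
  by apply: submoduleD => //; [apply: submoduleZ => //; apply: Nr | apply: Ns].
- by move=> h; apply: nTL' => v Tv; rewrite -[v]scale1r; apply: h.
move=> r /existsNP[v /not_implyP[Tv nrv]].
have gen w : T w -> ~ L' w -> T `<=` adjoin L' w.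
  move=> Tw nLw; apply: contrapT => nT; apply: nLw.
  apply: (Lmax (adjoin L' w)); last exact: adjoin_mem.
    split=> //; first exact: submodule_adjoin.
    move=> u [c Lu]; apply: (submodule_subl sT (L'T _ Lu)).
    exact: submoduleZ.
  exact: sub_adjoin.
have [u Luv] : adjoin L' (r *: v) v by apply: (gen (r *: v)) => //; apply: submoduleZ.
exists u => w Tw.
have nLv : ~ L' v by move=> L'v; apply: nrv; apply: submoduleZ.
have [c Lcw] := gen v Tv nLv w Tw.
have -> : (1 - u * r) *: w = (1 - u * r) *: (w - c *: v) + c *: (v - u *: (r *: v)).
  have -> : v - u *: (r *: v) = (1 - u * r) *: v by rewrite scalerBl scale1r scalerA.
  by rewrite [c *: (_ *: v)]scalerA [c * _]mulrC -scalerA -scalerDr subrK.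
by apply: submoduleD => //; apply: submoduleZ.
Qed.

(** Each of these primes gives a proper submodule of [T], the Cartier submodule
    generated by [A V], and one may enlarge it to a maximal submodule [L] of [T],
    whose residue field is [R / m] for one of the finitely many maximal ideals
    [m].  By comaximality the successive intersections of the [L i] with the same
    [m] would strictly decrease, which is impossible in the finite-dimensional
    space [T / m T]. *)
Lemma maximal_special_prime_finite A :
  finite_set [set m : set R | proper_maximal m] -> finite_set (maximal_special_prime A).
Proof.
move=> finM; pose T := cartier_hull A.
have cT : cartier T := cartier_cartier_hull A; have [sT _] := cT.
pose attached m Q := maximal_special_prime A Q /\ exists N L,
  [/\ cartier N, Q = quotient_ann N, submodule L /\ T `&` N `<=` L,
      L `<=` T /\ ~ T `<=` L & m = [set r | forall v, T v -> L (r *: v)]].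
apply: (@sub_finite_set _ _
  (\bigcup_(m in [set m : set R | proper_maximal m]) attached m)).
  move=> Q maxQ; have [[prQ [N cN QN]] nAQ _] := maxQ.
  have sTN : submodule (T `&` N) by apply: submoduleI => //; case: cN.
  have [||L [sL NL LT nTL mm]] := exists_maximal_above sTN sT.
  - by move=> v [].
  - move=> TTN; apply: nAQ => a Aa; rewrite QN => v.
    by apply: (TTN (a *: v) _).2; apply: cartier_hull_mem.
  exists [set r | forall v, T v -> L (r *: v)] => //; split=> //.
  by exists N, L; split.
apply: bigcup_finite => // m mm; apply: contrapT => /infiniteP/card_leP[f].
pose Q i := val (f (to_setT i)).
have QP i : attached m (Q i) by apply/set_mem; apply: valP.
have injQ : injective Q.
  move=> i j /val_inj e.
  have /(_ (to_setT i) (to_setT j)) := 'inj_f.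
  by rewrite !inE => /(_ Logic.I Logic.I e) /(congr1 val).
have [N NP] := boolp.choice (fun i => (QP i).2).
have [L LP] := boolp.choice NP.
have sL i : submodule (L i) by have [_ _ []] := LP i.
have prm := proper_maximal_prime mm.
pose K n := T `&` \bigcap_(i in `I_n) L i.
have sK n : submodule (K n).
  by apply: submoduleI => //; apply: submodule_bigcap => i _.
(* [U] contains [m T], so that [T / U] is a vector space over [R / m]. *)
pose U := T `&` \bigcap_i L i.
have sU : submodule U by apply: submoduleI => //; apply: submodule_bigcap.
have mL r v i : m r -> T v -> L i (r *: v).
  by have [_ _ _ _ ->] := LP i => h; apply: h.
have mU r v : m r -> T v -> U (r *: v).
  by move=> mr Tv; split=> [|i _]; [apply: (submoduleZ (N := T)) | apply: mL].
have sat N' : submodule N' -> U `<=` N' -> saturated m T N'.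
  move=> sN' UN' s u ms Tu Nsu; have [_ _ /(_ s ms)[c mc]] := mm.
  have -> : u = (1 - c * s) *: u + c *: (s *: u).
    by rewrite scalerBl scale1r scalerA subrK.
  by apply: submoduleD => //; [apply/UN'/mU | apply: submoduleZ].
have UK n : U `<=` K n by move=> v [Tv Lv]; split=> // i _; apply: Lv.
have [n Kn] : exists n, K n `<=` K n.+1.
  apply: (descending_chain_stops noethV prm sT sU (sat U sU (fun _ => id))).
  - by move=> n; split=> //; [apply: sat | move=> v []].
  - by move=> n v [Tv Lv]; split=> // i i_n; apply: Lv; apply: ltnW.
  move=> N' sN' satN' UN' N'T /existsNP[v /not_implyP[Tv nNv]].
  by exists v; split=> // r mr; apply/UN'/mU.
have [_ _ [_ NL] [_ nTL] _] := LP n; apply: nTL.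
apply: (@maximal_special_comaximal A Q N n) => //.
- by move=> i; case: (QP i).
- by move=> i; have [cN QN _ _ _] := LP i.
move=> v [Tv Nv]; have [|_] := Kn v; last by apply; rewrite /= ltnSn.
split=> // i i_n; have [_ _ [_ NLi] _ _] := LP i.
by apply: NLi; split=> //; apply: Nv.
Qed.

(** Induction on the number [k] of special primes that can be stacked above:
    those of level [k] are maximal among the special primes that do not contain
    the intersection of the finitely many special primes of lower level. *)
Lemma special_prime_level_finite k :
    finite_set [set m : set R | proper_maximal m] ->
  finite_set [set Q | special_prime Q /\ ~ chain_above special_prime k Q].
Proof.
move=> finM; elim: k => [|k IH].
  by apply: sub_finite_set (finite_set0 _) => Q [_ /(_ I)].
pose F := [set Q | special_prime Q /\ ~ chain_above special_prime k Q].
pose A := \bigcap_(Q in F) Q.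
have AP Q : special_prime Q -> A `<=` Q -> F Q.
  move=> spQ AQ; have [prQ _] := spQ.
  have /finite_seqP[s sE] := IH.
  have [||i i_s siQ] := @prime_bigcap R Q (size s) (nth setT s) prQ.
  - move=> i; case: (ltnP i (size s)) => [/(mem_nth setT) si|?]; last first.
      by rewrite nth_default.
    have : F (nth setT s i) by rewrite /F sE.
    by case=> -[[]].
  - move=> r rs; apply: AQ => Q' FQ'; have : [set` s] Q' by rewrite -sE.
    move=> /= Q's; rewrite -(nth_index setT Q's); apply: rs.
    by rewrite /= index_mem.
  have [_ nk] : F (nth setT s i) by rewrite /F sE /=; apply: mem_nth.
  by split=> // Qk; apply/nk/(chain_above_le siQ).
apply: (@sub_finite_set _ _ (F `|` maximal_special_prime A)); last first.
  by rewrite finite_setU; split=> //; apply: maximal_special_prime_finite.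
move=> Q [spQ nk]; case: (pselect (A `<=` Q)) => AQ; first by left; apply: AP.
right; split=> // Q' spQ' nAQ' QQ'; apply: contrapT => nQ'Q; apply: nAQ'.
suff FQ' : F Q' by move=> r; apply.
by split=> // Q'k; apply: nk; exists Q'.
Qed.

Lemma special_finite :
  finite_set [set m : set R | proper_maximal m] -> finite_set special.
Proof.
move=> finM.
have [n nP] := semilocal_finite_dimension noethR finM.
have /finite_seqP[s sE] : finite_set special_prime.
  apply: sub_finite_set (special_prime_level_finite n finM) => Q spQ; split=> //.
  by apply: nP => // P [].
pose meet (g : {ffun 'I_(size s) -> bool}) : set R :=
  [set r | forall i, g i -> nth setT s i r].
apply: (@sub_finite_set _ _ (meet @` setT)); last exact: finite_image.
move=> b spb; exists [ffun i => `[< b `<=` nth setT s (i : 'I_(size s)) >]] => //.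
apply/seteqP; split=> r; last first.
  by move=> br i; rewrite ffunE => /asboolP; apply.
move=> rP; apply: contrapT => nbr.
have [Q [spQ bQ nQr]] := special_prime_avoiding spb nbr.
have Qs : Q \in s by move: spQ; rewrite sE.
have Qi : (index Q s < size s)%N by rewrite index_mem.
apply: nQr; have := rP (Ordinal Qi); rewrite ffunE /= nth_index //.
by apply; apply/asboolP.
Qed.

End Cartier.

(** * Right modules over the Frobenius skew polynomial ring *)

Lemma semilocal_finite_proper_maximal (R : comNzRingType) :
  semilocal R -> finite_set [set m : set R | proper_maximal m].
Proof.
move=> slR; apply: sub_finite_set slR => m [im m1 mmax].
pose B : pred R := fun r => `[< m r >].
have closedB : idealr_closed (B : {pred R}).
  split; [exact/asboolP/(submodule0 im) | exact/asboolP |].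
  move=> a u v /asboolP mu /asboolP mv; apply/asboolP.
  by apply: idealD => //; apply: ideal_mull.
pose BI : idealr R := HB.pack_for (idealr R) B (isIdealr.Build R B closedB).
exists BI; last by apply/seteqP; split=> r /asboolP.
move=> J BJ r Jr; apply/asboolP; apply: contrapT => /mmax[u mu].
have : 1 \in J.
  rewrite -[1](subrK (u * r)); apply: rpredD; first exact/BJ/asboolP.
  exact: idealMr.
by rewrite idealr1.
Qed.

Section SkewModules.
Variables (R : comNzRingType) (p : nat) (chRp : p \in [pchar R]).
Variable M : lmodType (frob_skew chRp)^c.
Hypothesis divM : x_divisible M.
Implicit Types (N : submodClosed M) (k : M) (r : R).

Local Notation x := (skew_x chRp).

Definition act_x (v : restrict_scalars M) : restrict_scalars M := ract (v : M) x.

Lemma act_xD u v : act_x (u + v) = act_x u + act_x v.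
Proof. exact: (@scalerDr _ M). Qed.

Lemma act_xZ r v : act_x (r ^+ p *: v) = r *: act_x v.
Proof.
rewrite -[LHS]/(ract (ract (v : M) (skew_const chRp (r ^+ p))) x).
by rewrite -ractM -skew_xM ractM.
Qed.

Lemma x_divisibleX i k : exists l, k = ract l (x ^+ i).
Proof.
elim: i k => [|i IH] k; first by exists k; rewrite expr0; apply/esym/scale1r.
have [l ->] := divM k; have [l' ->] := IH l.
by exists l'; rewrite exprSr ractM.
Qed.

Definition restrict_submod N : set (restrict_scalars M) := [set v | (v : M) \in N].

Lemma cartier_restrict_submod N : cartier act_x (restrict_submod N).
Proof.
split; last by move=> v Nv; apply: (rpredZ (skew_x chRp : (frob_skew chRp)^c)).
split=> [|a u v Nu Nv]; first exact: (rpred0 N).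
apply: (@rpredD M N) => //.
exact: (rpredZ (skew_const chRp a : (frob_skew chRp)^c)).
Qed.

(** If [r x^i] annihilates [M / N] then so does [r]: each [v] has the form
    [w x^i], whence [v r = w r^(p^i) x^i] and [r] divides [r^(p^i)]. *)
Lemma quotient_kills_monomial N r i :
  (forall k : quot_mod N, ract k (skew_monomial chRp r i) = 0) <->
  quotient_ann (restrict_submod N) r.
Proof.
have proj (k : M) s : ract (quot_proj N k) s = quot_proj N (ract k s).
  exact/esym/(@quot_projZ _ M N).
have proj0 (k : M) : quot_proj N k = 0 <-> k \in N.
  by rewrite -[0](raddf0 (quot_proj N)) quot_projP subr0.
split=> [kill v|Nr k].
  have [w ->] := x_divisibleX i v.
  rewrite /restrict_submod /= -[_ *: _]/(ract (ract w (x ^+ i)) (skew_const chRp r)).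
  rewrite -ractM skew_xX skew_monomialM mul1r addn0.
  have p_gt0 : (0 < p ^ i)%N by rewrite expn_gt0 prime_gt0 //; case/andP: chRp.
  have -> : skew_monomial chRp (r ^+ (p ^ i)) i =
      skew_const chRp (r ^+ (p ^ i).-1) * skew_monomial chRp r i.
    by rewrite skew_monomialM expn0 expr1 -exprSr prednK.
  by rewrite ractM; apply/proj0; rewrite -proj kill.
have [v <-] := quot_proj_surj k.
rewrite proj; apply/proj0; rewrite skew_monomialE ractM.
have Nrv : ract v (skew_const chRp r) \in N := Nr v.
by move: (x ^+ i) => s; apply: (rpredZ (s : (frob_skew chRp)^c)).
Qed.

Lemma gr_ann_quotient N :
  gr_ann (quot_mod N) =
  [set a | forall i, quotient_ann (restrict_submod N) (skew_coef a i)].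
Proof.
apply/seteqP; split=> a ha i.
  by apply/(quotient_kills_monomial N _ i) => k; apply: ha.
by apply/quotient_kills_monomial.
Qed.

End SkewModules.

Theorem theorem1p12 (R : comNzRingType) (p : nat) (chRp : p \in [pchar R])
    (R_noetherian : noetherian R^o) (R_semilocal : semilocal R)
    (M : lmodType (frob_skew chRp)^c)
    (M_divisible : x_divisible M)
    (M_noetherian : noetherian (restrict_scalars M)) :
  finite_set [set gr_ann (quot_mod N) | N in [set: submodClosed M]].
Proof.
have p_gt1 : (1 < p)%N by case/andP: (chRp) => /prime_gt1.
have := special_finite p_gt1 (@act_xD _ _ _ M) (@act_xZ _ _ _ M) M_divisible
  R_noetherian M_noetherian (semilocal_finite_proper_maximal R_semilocal).
move=> /(finite_image (fun b : set R => [set a : frob_skew chRp |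
  forall i, b (skew_coef a i)])).
apply: sub_finite_set => _ [N _ <-].
exists (quotient_ann (restrict_submod N)); last by rewrite gr_ann_quotient.
by exists (restrict_submod N) => //; apply: cartier_restrict_submod.
Qed.
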